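(* Let $G$ be a mitotic group. Then $\operatorname{bcd}(G) = 0$.
   Context: Conventions: $\mathbb{N}$ contains $0$; for group elements $g,h$ write $g^h := h\cdot g\cdot h^{-1}$; $[\cdot,\cdot]$ denotes the commutator. Mitosis: Let $G$ be a subgroup of a group $M$. Then $M$ is a mitosis of $G$ if there exist $s,d\in M$ such that (1) $M$ is generated by $G\cup\{s,d\}$; (2) for all $g\in G$ we have $g^d = g\cdot g^s$; (3) for all $g,g'\in G$ we have $[g',g^s]=1$. A group $M$ is mitotic if for every finitely generated subgroup $G\subset M$ there exists a subgroup $M'\subset M$ such that $G\subset M'$ and $M'$ is a mitosis of $G$. Bounded cohomology: For a group $G$ and $k\in\mathbb{N}$ let $C_k(G;\mathbb{R}) := \bigoplus_{g\in G^k}\mathbb{R}\cdot g$ with boundary operator $\partial_k(g_1,\dots,g_k) = (g_2,\dots,g_k)+\sum_{j=1}^{k-1}(-1)^j (g_1,\dots,g_j g_{j+1},\dots,g_k)+(-1)^k(g_1,\dots,g_{k-1})$, and let $\|\cdot\|_1$ be the $\ell^1$-norm with respect to the basis $G^k$. The bounded cochain complex $C_b^*(G;\mathbb{R})$ is the topological dual of $C_*(G;\mathbb{R})$ with respect to $\|\cdot\|_1$ (bounded linear functionals, with the dual coboundary operator). Its cohomology is the bounded cohomology $H_b^*(G;\mathbb{R})$. Bounded-cohomological dimension: $\operatorname{bcd}(G) := \sup\{n\in\mathbb{N} \mid H_b^n(G;\mathbb{R})\not\cong 0\}\in\mathbb{N}\cup\{\infty\}$. *)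

(* Defs.v *)
From HB Require Import structures.
From mathcomp Require Import all_boot all_order all_algebra.
From mathcomp Require Import all_classical reals ereal.
From mathcomp Require Import freeg.

Set Implicit Arguments.
Unset Strict Implicit.
Unset Printing Implicit Defensive.

Import Order.TTheory GRing.Theory Num.Theory.

Local Open Scope classical_set_scope.
Local Open Scope ring_scope.

Section Mitosis.
Variable M : groupType.
Implicit Types H K S : set M.
Local Open Scope group_scope.

Definition subgroup H : Prop := group_closed [in H].

Definition generated S : set M := smallest subgroup S.

Definition finitely_generated H : Prop :=
  exists2 S : set M, finite_set S & H = generated S.

(* The convention is g^h = h g h^-1, whereas the library's [g ^ h] is
   h^-1 g h. *)
Definition lconj (g h : M) : M := h * g * h^-1.

(* Subgroups being sets in an ambient group, the group generated by
   H `|` [set s; d] is the same computed in K or in M, as s, d and H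
   lie in K. *)
Definition mitosis H K : Prop :=
  exists s d : M,
    [/\ K s, K d,
        K = generated (H `|` [set s; d]),
        forall g, H g -> lconj g d = g * lconj g s &
        forall g g', H g -> H g' -> [~ g', lconj g s] = 1].

End Mitosis.

Definition mitotic (M : groupType) : Prop :=
  forall H : set M, subgroup H -> finitely_generated H ->
    exists K : set M, [/\ subgroup K, H `<=` K & mitosis H K].

(* Quotient of a module by a submodule, for which the library only provides
   the structure of additive group. *)
Section QuotientLmodule.
Variables (R : nzRingType) (V : lmodType R).
Variables (I : {pred V}) (submodI : submod_closed I).
Local Open Scope quotient_scope.

Let S : {pred V} := I.
HB.instance Definition _ := GRing.isSubmodClosed.Build R V S submodI.

Definition lmod_quot := @Quotient.quot V S.
Local Notation Q := lmod_quot.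

HB.instance Definition _ := GRing.Zmodule.on Q.
HB.instance Definition _ := ZmodQuotient.on Q.

Implicit Type x : Q.

Definition quot_scale (a : R) (x : Q) : Q := \pi_Q (a *: repr x).

Lemma pi_quot_scale a (v : V) : quot_scale a (\pi_Q v) = \pi_Q (a *: v).
Proof.
apply/eqP; rewrite /quot_scale -Quotient.idealrBE -scalerBr rpredZ //.
by rewrite Quotient.idealrBE reprK; exact: eqxx.
Qed.

Fact quot_scalerA a b (x : Q) :
  quot_scale a (quot_scale b x) = quot_scale (a * b) x.
Proof.
by elim/quotW: x => v; rewrite (pi_quot_scale b) !pi_quot_scale scalerA.
Qed.

Fact quot_scale1r : left_id 1 quot_scale.
Proof. by elim/quotW=> v; rewrite pi_quot_scale scale1r. Qed.

Fact quot_scalerDr : right_distributive quot_scale +%R.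
Proof.
move=> a; elim/quotW=> v; elim/quotW=> w.
rewrite (pi_quot_scale a v) (pi_quot_scale a w) -!pi_addr.
by rewrite pi_quot_scale scalerDr.
Qed.

Fact quot_scalerDl (x : Q) : {morph quot_scale^~ x : a b / a + b}.
Proof.
elim/quotW: x => v a b.
rewrite (pi_quot_scale a) (pi_quot_scale b) (pi_quot_scale (a + b)).
by rewrite -pi_addr scalerDl.
Qed.

HB.instance Definition _ := GRing.Zmodule_isLmodule.Build R Q
  quot_scalerA quot_scale1r quot_scalerDr quot_scalerDl.

End QuotientLmodule.

Fact fglift_is_linear (R : nzRingType) (K : choiceType) (V : lmodType R)
  (f : K -> V) : linear (fglift f : {freeg K / R} -> V).
Proof.
have fgD : zmod_morphism (fglift f : {freeg K / R} -> V).
  exact: lift_is_additive.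
pose h := HB.pack_for {additive {freeg K / R} -> V}
  (fglift f : {freeg K / R} -> V)
  (GRing.isZmodMorphism.Build _ _ _ fgD).
have fgE : fglift f = h by [].
move=> a x y; rewrite fgE raddfD; congr (_ + _).
rewrite -[x]freeg_sumE scaler_sumr 2!(raddf_sum h) scaler_sumr.
apply: eq_bigr => z _ /=; rewrite !liftU scalerA.
have -> : a *: << coeff z x *g z >> = << a * coeff z x *g z >>.
  by apply/eqP/freeg_eqP => w; rewrite coeffZ !coeffU mulrA.
by rewrite liftU.
Qed.

Section BoundedCohomology.
Variables (R : realType) (G : groupType).

Definition chain (k : nat) := {freeg (k.-tuple G) / R}.
HB.instance Definition _ k := GRing.Lmodule.on (chain k).

Definition l1norm k (c : chain k) : R := \sum_(g <- dom c) `|coeff g c|.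

Section Faces.
Variables (k : nat) (g : k.+1.-tuple G).

Definition first_face : k.-tuple G :=
  [tuple tnth g (fintype.lift ord0 i) | i < k].

(* With indices starting at 0, this is (g_0, ..., g_j g_(j+1), ..., g_k). *)
Definition inner_face (j : nat) : k.-tuple G :=
  [tuple if (i < j)%N then tnth g (widen_ord (leqnSn k) i)
         else if i == j :> nat then
           (tnth g (widen_ord (leqnSn k) i) * tnth g (fintype.lift ord0 i))%g
         else tnth g (fintype.lift ord0 i) | i < k].

Definition last_face : k.-tuple G :=
  [tuple tnth g (widen_ord (leqnSn k) i) | i < k].

End Faces.

(* The operator from degree k+1 to degree k; its j-th inner face is the
   (j+1)-st term of the usual sum, indexed from 1. *)
Definition boundary_basis k (g : k.+1.-tuple G) : chain k :=
  << first_face g >>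
  + \sum_(j < k) (-1) ^+ j.+1 *: << inner_face g j >>
  + (-1) ^+ k.+1 *: << last_face g >>.

Definition boundary k : chain k.+1 -> chain k := fglift (@boundary_basis k).

HB.instance Definition _ k := GRing.isLinear.Build R (chain k.+1) (chain k)
  *:%R (@boundary k) (@fglift_is_linear _ _ _ (@boundary_basis k)).

(* The topological dual of [chain k] for [l1norm]. *)
Definition bounded_functional k : {pred chain k -> R^o} :=
  fun f => `[< linear f /\
               exists C : R, forall c, `|f c| <= C * l1norm c >].

Fact bounded_functional_submod k : submod_closed (@bounded_functional k).
Proof.
split.
  rewrite unfold_in; apply/asboolP; split.
    by move=> a x y; rewrite scaler0 addr0.
  by exists 0 => c; rewrite normr0 mul0r.
move=> a f h; rewrite !unfold_in.
move=> /asboolP[flin [Cf fC]] /asboolP[hlin [Ch hC]]; apply/asboolP; split.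
  move=> b x y; rewrite !fctE flin hlin !scalerDr !scalerA [b * a]mulrC.
  by rewrite addrACA.
exists (`|a| * Cf + Ch) => c; rewrite mulrDl.
apply: le_trans (ler_normD _ _) _; apply: lerD => //.
by rewrite normrM -mulrA ler_wpM2l.
Qed.

HB.instance Definition _ k := GRing.isSubmodClosed.Build R _
  (@bounded_functional k) (@bounded_functional_submod k).

Record cochain k := Cochain {
  cochain_fun :> chain k -> R^o;
  _ : bounded_functional cochain_fun }.

HB.instance Definition _ k := [isSub for @cochain_fun k].
HB.instance Definition _ k := [Choice of cochain k by <:].
HB.instance Definition _ k := [SubChoice_isSubLmodule of cochain k by <:].

Fact l1norm_basis k (g : k.-tuple G) : l1norm (<< g >> : chain k) = 1.
Proof. by rewrite /l1norm domU1 big_seq1 coeffU eqxx mulr1 normr1. Qed.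

Fact coboundary_subproof k (f : cochain k) :
  bounded_functional (f \o @boundary k : chain k.+1 -> R^o).
Proof.
case: f => f /= /asboolP[flin [C fC]].
pose F := HB.pack_for {linear chain k -> R^o} f
  (GRing.isLinear.Build R (chain k) R^o *:%R f flin).
have fE : f = F by [].
have F1 (g : k.-tuple G) : `|F << g >>| <= C.
  by rewrite -fE (le_trans (fC _)) // l1norm_basis mulr1.
have Fs n (g : k.-tuple G) : `|F ((-1) ^+ n *: << g >>)| <= C.
  by rewrite linearZ normrM normrX normrN1 expr1n mul1r.
have Fb (g : k.+1.-tuple G) : `|F (boundary_basis g)| <= C *+ k.+2.
  rewrite /boundary_basis !linearD linear_sum mulrSr.
  apply: le_trans (ler_normD _ _) _; apply: lerD => //.
  rewrite mulrS; apply: le_trans (ler_normD _ _) _; apply: lerD => //.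
  apply: le_trans (ler_norm_sum _ _ _) _.
  apply: le_trans (ler_sum _ (fun i _ => Fs _ _)) _.
  by rewrite sumr_const card_ord.
apply/asboolP; split; first by move=> a x y /=; rewrite linearP flin.
exists (C *+ k.+2) => c /=; rewrite fE -{1}[c]freeg_sumE !linear_sum.
apply: le_trans (ler_norm_sum _ _ _) _; rewrite mulr_sumr.
apply: ler_sum => g _; rewrite /= /boundary liftU -[f _]/(F _).
rewrite linearZ normrM mulrC.
exact: ler_wpM2r.
Qed.

Definition coboundary k (f : cochain k) : cochain k.+1 :=
  Cochain (coboundary_subproof f).

Fact coboundary_is_linear k : linear (@coboundary k).
Proof. by move=> a f h; apply/val_inj. Qed.

HB.instance Definition _ k := GRing.isLinear.Build R (cochain k) (cochain k.+1)
  *:%R (@coboundary k) (@coboundary_is_linear k).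

Definition is_cocycle k : {pred cochain k} := fun f => coboundary f == 0.

Fact is_cocycle_submod k : submod_closed (@is_cocycle k).
Proof.
split; first by rewrite unfold_in /is_cocycle linear0.
move=> a f h; rewrite !unfold_in /is_cocycle => /eqP f0 /eqP h0.
by rewrite linearP /= f0 h0 scaler0 addr0.
Qed.

HB.instance Definition _ k := GRing.isSubmodClosed.Build R _
  (@is_cocycle k) (@is_cocycle_submod k).

Record cocycle k := Cocycle {
  cocycle_val :> cochain k;
  _ : is_cocycle cocycle_val }.

HB.instance Definition _ k := [isSub for @cocycle_val k].
HB.instance Definition _ k := [Choice of cocycle k by <:].
HB.instance Definition _ k := [SubChoice_isSubLmodule of cocycle k by <:].

Definition is_coboundary k : {pred cocycle k} :=
  match k with
  | 0 => fun z => z == 0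
  | k'.+1 => fun z => `[< exists f : cochain k', coboundary f = z >]
  end.

Fact is_coboundary_submod k : submod_closed (@is_coboundary k).
Proof.
case: k => [|k]; split; rewrite ?unfold_in /=.
- by rewrite eqxx.
- move=> a x y; rewrite !unfold_in /= => /eqP-> /eqP->.
  by rewrite scaler0 addr0.
- by apply/asboolP; exists 0; rewrite linear0.
- move=> a x y; rewrite !unfold_in /= => /asboolP[f fx] /asboolP[h hy].
  by apply/asboolP; exists (a *: f + h); rewrite linearP /= fx hy.
Qed.

Definition Hb k : lmodType R := lmod_quot (@is_coboundary_submod k).

(* In [\bar R] the supremum of the empty set is -oo; it does not occur, as
   [Hb 0] is one-dimensional. *)
Definition bcd : \bar R :=
  ereal_sup [set n%:R%:E | n in [set n : nat | exists x : Hb n, x != 0]].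

End BoundedCohomology.

(* Main.v *)
Require Import Defs.
From HB Require Import structures.
From mathcomp Require Import all_boot all_order all_algebra.
From mathcomp Require Import all_classical reals ereal topology normedtype.
From mathcomp Require Import freeg ring zify.

Set Implicit Arguments.
Unset Strict Implicit.
Unset Printing Implicit Defensive.

Import Order.TTheory GRing.Theory Num.Theory.
Import numFieldNormedType.Exports.
Local Open Scope classical_set_scope.
Local Open Scope ring_scope.

(** Why bounded cohomology vanishes in positive degrees.

     Let [i] be the inclusion of a group in a larger one, with [s] and [d]
    such that [i(g)^d = i(g) i(g)^s] and all [i(g)] commute with all
    [i(g')^s]. Then [(g, g') |-> i(g) i(g')^s] is a homomorphism whose
    restriction to the diagonal is [i^d]. By the theorem of Eilenberg and
    Zilber, the chain map of [i^d] is therefore homotopic to the sum, over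
    the splittings of a simplex in a front and a back, of the cross products
    of [i(front)] and [i(back)^s]. If [i] is already homotopic to the
    trivial homomorphism 1 in degrees < N, then the cross product of [i - 1]
    with itself is null-homotopic in degrees < N + 1, since [i - 1] vanishes
    on points. Expanding this square, [i^d - i - i^s + 1] is null-homotopic;
    as conjugations are homotopic to the identity, so is [i - 1]. This is
    [mitosis_null_homotopic].

     In a mitotic group every finitely generated subgroup can be enlarged
    repeatedly by mitoses, and so its inclusion in the whole group is
    homotopic to the trivial homomorphism up to any prescribed degree
    ([mitotic_inclusion_null_homotopic]). All homotopies are linear
    operators given by universal formulas, hence have norms bounded by
    constants that depend only on the degree, not on the subgroup.

     A bounded cocycle of positive degree composed with these homotopies
    has, on each finitely generated subgroup, a primitive with a bound
    independent of the subgroup. The unit balls being compact for pointwise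
    convergence, the primitives converge along an ultrafilter to a bounded
    primitive on the whole group ([cocycle_limit],
    [bounded_cocycle_is_coboundary]). In degree 0 the constant functional is
    a cocycle which is not zero, so the supremum is 0.

     The computations are done on homogeneous simplices, that is sequences
    of group elements, where all chain homotopies are obtained by coning
    from the first vertex ([equivariant_null_homotopic]); results are read
    in the coinvariants. The comparison with the inhomogeneous complex is
    made only at the end, by [homogenize_bd]. *)

(** * Linear extension from a basis *)

Section LinearExtension.
Variables (R : nzRingType) (K : choiceType).

Definition ext (V : lmodType R) (F : K -> V) : {freeg K / R} -> V := fglift F.
HB.instance Definition _ (V : lmodType R) (F : K -> V) :=
  GRing.isLinear.Build R {freeg K / R} V *:%R (ext F) (fglift_is_linear F).

Variable V : lmodType R.

Lemma ext_basis (F : K -> V) k : ext F << k >> = F k.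
Proof. by rewrite /ext liftU scale1r. Qed.

Lemma linear_ext (f : {linear {freeg K / R} -> V}) c :
  f c = ext (fun k => f << k >>) c.
Proof.
rewrite -[c]freeg_sumE !linear_sum; apply: eq_bigr => k _ /=.
have -> : << coeff k c *g k >> = coeff k c *: << k >>.
  by apply/eqP/freeg_eqP => w; rewrite coeffZ !coeffU mul1r.
by rewrite !linearZ /= ext_basis.
Qed.

Lemma eq_ext (F F' : K -> V) : F =1 F' -> ext F =1 ext F'.
Proof. by move=> /funext ->. Qed.

Lemma eq_linear (f g : {linear {freeg K / R} -> V}) :
  (forall k, f << k >> = g << k >>) -> f =1 g.
Proof. by move=> fg c; rewrite linear_ext (eq_ext fg) -linear_ext. Qed.

Lemma ext_addfun (F F' : K -> V) c : ext (F \+ F') c = ext F c + ext F' c.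
Proof.
by apply: (@eq_linear (ext (F \+ F')) (ext F \+ ext F')) => k /=;
  rewrite !ext_basis.
Qed.

Lemma ext_subfun (F F' : K -> V) c : ext (F \- F') c = ext F c - ext F' c.
Proof.
by apply: (@eq_linear (ext (F \- F')) (ext F \- ext F')) => k /=;
  rewrite !ext_basis.
Qed.

Lemma ext_cst0 c : ext (fun=> 0 : V) c = 0.
Proof.
by apply: (@eq_linear (ext (fun=> 0)) \0) => k /=; rewrite ext_basis.
Qed.

End LinearExtension.

Lemma linear_ext_comp (R : nzRingType) (K : choiceType) (V W : lmodType R)
    (g : {linear V -> W}) (F : K -> V) c :
  g (ext F c) = ext (g \o F) c.
Proof.
apply: (@eq_linear _ _ _ (g \o ext F) (ext (g \o F))) => k /=.
by rewrite !ext_basis.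
Qed.

(** * Homogeneous augmented chains *)

Section ChainComplex.
Variable R : comNzRingType.
Local Notation chains X := {freeg (seq X) / R}.

Section OneType.
Variable X : choiceType.
Implicit Types (x : X) (s : seq X) (c : chains X).

(** A sequence of n + 1 points is a simplex of degree n, and the empty
    sequence is the generator of the augmentation in degree -1. With the
    augmentation, the rule [bd_cone] holds without exception, and it defines
    [bd] by recursion: it is the usual alternating sum of faces, by
    [bd_faces]. *)
Definition cone x : chains X -> chains X := ext (fun s => << x :: s >>).
HB.instance Definition _ x := GRing.Linear.on (cone x).

Fixpoint bd_simplex s : chains X :=
  if s is x :: s' then << s' >> - cone x (bd_simplex s') else 0.

Definition bd : chains X -> chains X := ext bd_simplex.
HB.instance Definition _ := GRing.Linear.on bd.

Lemma cone_simplex x s : cone x << s >> = << x :: s >>.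
Proof. exact: ext_basis. Qed.

Lemma ext_cone (V : lmodType R) (F : seq X -> V) x c :
  ext F (cone x c) = ext (fun s => F (x :: s)) c.
Proof.
by rewrite linear_ext_comp; apply: eq_ext => s; rewrite /= ext_basis.
Qed.

Lemma bd_nil : bd << [::] >> = 0.
Proof. exact: ext_basis. Qed.

Lemma bd_cons x s : bd << x :: s >> = << s >> - cone x (bd << s >>).
Proof. by rewrite /bd !ext_basis. Qed.

Lemma bd_cone x c : bd (cone x c) = c - cone x (bd c).
Proof.
apply: (@eq_linear _ _ _ (bd \o cone x) (idfun \- (cone x \o bd))) => s /=.
by rewrite cone_simplex bd_cons.
Qed.

Lemma bd_bd c : bd (bd c) = 0.
Proof.
apply: (@eq_linear _ _ _ (bd \o bd) \0) => s /=.
elim: s => [|x s IHs]; first by rewrite bd_nil linear0.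
by rewrite bd_cons linearB /= bd_cone IHs linear0 subr0 subrr.
Qed.

(** Homogeneity is expressed by a projector, so that it passes through
    linear maps by rewriting, without talking about the support of a chain. *)
Definition homog_part n : chains X -> chains X :=
  ext (fun s => if size s == n then << s >> else 0).
HB.instance Definition _ n := GRing.Linear.on (homog_part n).

Definition homog n c : Prop := homog_part n c = c.

Lemma eq_ext_homog (V : lmodType R) (F F' : seq X -> V) n c :
    homog n c -> (forall s, size s = n -> F s = F' s) ->
  ext F c = ext F' c.
Proof.
move=> cn FF'; rewrite -cn !linear_ext_comp; apply: eq_ext => s /=.
by case: eqP => [/FF'|]; rewrite ?ext_basis ?linear0.
Qed.

Lemma homog0 n : homog n 0.
Proof. exact: linear0. Qed.

Lemma homogD n c c' : homog n c -> homog n c' -> homog n (c + c').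
Proof. by move=> cn c'n; rewrite /homog linearD /= cn c'n. Qed.

Lemma homogZ n a c : homog n c -> homog n (a *: c).
Proof. by move=> cn; rewrite /homog linearZ /= cn. Qed.

Lemma homogB n c c' : homog n c -> homog n c' -> homog n (c - c').
Proof. by move=> cn c'n; rewrite /homog linearB /= cn c'n. Qed.

Lemma homog_simplex s : homog (size s) << s >>.
Proof. by rewrite /homog /homog_part ext_basis eqxx. Qed.

End OneType.

Lemma homog_map (X Y : choiceType) (f : X -> Y) s :
  homog (size s) << map f s >>.
Proof. by rewrite -(size_map f); exact: homog_simplex. Qed.

Lemma homog_ext (X Y : choiceType) (F : seq X -> chains Y) n m c :
    homog n c -> (forall s, size s = n -> homog m (F s)) ->
  homog m (ext F c).
Proof.
move=> cn Fm; rewrite /homog [LHS]linear_ext_comp.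
by apply: (eq_ext_homog cn) => s /Fm.
Qed.

Lemma homog_cone (X : choiceType) x n (c : chains X) :
  homog n c -> homog n.+1 (cone x c).
Proof.
by move=> cn; apply: homog_ext cn _ => s <-; exact: (homog_simplex (x :: s)).
Qed.

Lemma homog_bd (X : choiceType) n (s : seq X) :
  size s = n.+1 -> homog n (bd << s >>).
Proof.
elim: n s => [|n IHn] [|x s] //= [sn]; rewrite bd_cons.
  by rewrite (size0nil sn) bd_nil linear0 subr0; exact: (homog_simplex [::]).
by apply: homogB; [rewrite -sn; exact: homog_simplex|exact/homog_cone/IHn].
Qed.

Lemma eq_ext_bd (X : choiceType) (V : lmodType R) (F F' : seq X -> V) s :
    (forall t, (size t).+1 = size s -> F t = F' t) ->
  ext F (bd << s >>) = ext F' (bd << s >>).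
Proof.
case: s => [|x s] FF'; first by rewrite bd_nil !linear0.
apply: (@eq_ext_homog _ _ _ _ (size s)); first exact: homog_bd.
by move=> t ts; apply: FF'; rewrite ts.
Qed.

Definition mapc (X Y : choiceType) (f : X -> Y) : chains X -> chains Y :=
  ext (fun s => << map f s >>).
HB.instance Definition _ X Y f := GRing.Linear.on (@mapc X Y f).

Section Map.
Variables (X Y : choiceType) (f : X -> Y).
Implicit Types (c : chains X).

Lemma mapc_simplex s : mapc f << s >> = << map f s >>.
Proof. exact: ext_basis. Qed.

Lemma mapc_cone x c : mapc f (cone x c) = cone (f x) (mapc f c).
Proof.
apply: (@eq_linear _ _ _ (mapc f \o cone x) (cone (f x) \o mapc f)) => s /=.
by rewrite cone_simplex !mapc_simplex cone_simplex.
Qed.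

Lemma bd_mapc c : bd (mapc f c) = mapc f (bd c).
Proof.
apply: (@eq_linear _ _ _ (@bd Y \o mapc f) (mapc f \o @bd X)) => s /=.
elim: s => [|x s IHs]; rewrite mapc_simplex ?bd_nil ?linear0 //=.
by rewrite !bd_cons linearB /= mapc_simplex mapc_cone -IHs mapc_simplex.
Qed.

Lemma ext_mapc (V : lmodType R) (F : seq Y -> V) c :
  ext F (mapc f c) = ext (F \o map f) c.
Proof.
by rewrite linear_ext_comp; apply: eq_ext => s; rewrite /= ext_basis.
Qed.

End Map.

End ChainComplex.

(** * Coinvariants *)

Section Coinvariants.
Variable R : comNzRingType.
Local Notation chains X := {freeg (seq X) / R}.

Definition translate (A : groupType) (a : A) (s : seq A) : seq A :=
  map ( *%g a) s.

(** Chains on the homogeneous model of a group are translated by the group.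
    The coinvariants are represented by the simplices with first vertex 1:
    two chains agree in the coinvariants when they have the same image by
    [coinv]. *)
Definition rebase (A : groupType) (s : seq A) : seq A :=
  translate (head 1%g s)^-1%g s.

Lemma rebase_translate (A : groupType) (a : A) s :
  rebase (translate a s) = rebase s.
Proof.
case: s => //= x s; rewrite /rebase /translate /= -!map_comp.
congr (_ :: _); first by rewrite invgM -mulgA mulKg.
by apply: eq_map => y /=; rewrite invgM -mulgA mulKg.
Qed.

Definition coinv (A : groupType) : chains A -> chains A :=
  ext (fun s => << rebase s >>).
HB.instance Definition _ A := GRing.Linear.on (@coinv A).

Variables A : groupType.
Implicit Types (a : A) (s : seq A) (c : chains A).

Lemma coinv_simplex s : coinv << s >> = << rebase s >>.
Proof. exact: ext_basis. Qed.

Lemma coinv_translate a c : coinv (mapc ( *%g a) c) = coinv c.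
Proof.
rewrite [LHS]ext_mapc; apply: eq_ext => s /=.
by rewrite -[map _ s]/(translate a s) rebase_translate.
Qed.

Lemma coinv_bd c : coinv (bd (coinv c)) = coinv (bd c).
Proof.
apply: (@eq_linear _ _ _ (@coinv A \o (@bd R A \o @coinv A))
  (@coinv A \o @bd R A)).
move=> s /=; rewrite coinv_simplex /rebase /translate -mapc_simplex bd_mapc.
exact: coinv_translate.
Qed.

Lemma homog_coinv n c : homog n c -> homog n (coinv c).
Proof.
move=> cn; apply: homog_ext cn _ => s <-.
exact: homog_map.
Qed.

Lemma coinv_id c : coinv (coinv c) = coinv c.
Proof.
apply: (@eq_linear _ _ _ (@coinv A \o @coinv A) (@coinv A)) => s /=.
by rewrite !coinv_simplex rebase_translate.
Qed.

End Coinvariants.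

(** * Norm bounds *)

Section Bounded.
Variables (R : numDomainType).
Local Notation chains X := {freeg (seq X) / R}.

Section OneType.
Variable X : choiceType.
Implicit Types (c : chains X) (B : R).

(** This says that the l1-norm of [c] is at most [B], in the dual form: it
    is immediately compatible with linear extension. *)
Definition bounded B c : Prop :=
  forall (f : seq X -> R^o) (M : R),
    (forall s, `|f s| <= M) -> `|ext f c| <= B * M.

Lemma bounded_ge0 B c : bounded B c -> 0 <= B.
Proof.
move=> /(_ (fun=> 1) 1); rewrite normr1 mulr1 => cB.
exact: le_trans (normr_ge0 _) (cB _).
Qed.

Lemma bounded_le B B' c : B <= B' -> bounded B c -> bounded B' c.
Proof.
move=> BB' cB f M fM; apply: le_trans (cB f M fM) _.
by rewrite ler_wpM2r // (le_trans (normr_ge0 _) (fM [::])).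
Qed.

Lemma bounded0 : bounded 0 0.
Proof. by move=> f M _; rewrite linear0 normr0 mul0r. Qed.

Lemma bounded_simplex s : bounded 1 << s >>.
Proof. by move=> f M fM; rewrite ext_basis mul1r. Qed.

Lemma boundedD B B' c c' :
  bounded B c -> bounded B' c' -> bounded (B + B') (c + c').
Proof.
move=> cB cB' f M fM; rewrite linearD mulrDl.
exact: le_trans (ler_normD _ _) (lerD (cB _ _ fM) (cB' _ _ fM)).
Qed.

Lemma bounded_sign n B c : bounded B c -> bounded B ((-1) ^+ n *: c).
Proof.
by move=> cB f M fM; rewrite linearZ normrM normrX normrN1 expr1n mul1r cB.
Qed.

Lemma boundedN B c : bounded B c -> bounded B (- c).
Proof. by move=> /(@bounded_sign 1); rewrite expr1 scaleN1r. Qed.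

Lemma boundedB B B' c c' :
  bounded B c -> bounded B' c' -> bounded (B + B') (c - c').
Proof. by move=> cB /boundedN; exact: boundedD. Qed.

Lemma bounded_cone x B c : bounded B c -> bounded B (cone x c).
Proof. by move=> cB f M fM; rewrite ext_cone; exact: cB. Qed.

End OneType.

Lemma bounded_coinv (A : groupType) B (c : chains A) :
  bounded B c -> bounded B (coinv c).
Proof.
move=> cB f M fM; rewrite linear_ext_comp; apply: cB => s /=.
by rewrite ext_basis.
Qed.

(** The operators of interest are bounded in each degree, but not uniformly
    in the degree, whence the homogeneity of [c]. *)
Lemma bounded_ext_homog (X Y : choiceType) n B B' (F : seq X -> chains Y) c :
    homog n c -> bounded B c -> 0 <= B' ->
    (forall s, size s = n -> bounded B' (F s)) ->
  bounded (B * B') (ext F c).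
Proof.
move=> cn cB B'0 FB f M fM; rewrite linear_ext_comp.
rewrite (@eq_ext_homog _ _ _ _ (fun s => if size s == n then ext f (F s) else 0)
  n) //; last by move=> s /= ->; rewrite eqxx.
rewrite -mulrA; apply: cB => s; case: eqP => [/FB/(_ f M fM) //|_].
by rewrite normr0 mulr_ge0 // (le_trans (normr_ge0 _) (fM [::])).
Qed.

Lemma bounded_bd (X : choiceType) (s : seq X) :
  bounded (size s)%:R (bd << s >> : chains X).
Proof.
elim: s => [|x s IHs]; first by rewrite bd_nil; exact: bounded0.
rewrite bd_cons mulrSr addrC.
by apply: boundedB; [exact: bounded_simplex|exact: bounded_cone].
Qed.

Lemma bounded_ext_bd (X Y : choiceType) B (F : seq X -> chains Y) s :
    0 <= B -> (forall t, (size t).+1 = size s -> bounded B (F t)) ->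
  bounded ((size s)%:R * B) (ext F (bd << s >>)).
Proof.
case: s => [|x s] B0 FB.
  by rewrite bd_nil linear0 mul0r; exact: bounded0.
apply: bounded_ext_homog (bounded_bd _) B0 _; first exact: homog_bd.
by move=> t ts; apply: FB; rewrite ts.
Qed.

End Bounded.

(** * Null-homotopies *)

Section NullHomotopic.
Variable R : numDomainType.
Local Notation chains X := {freeg (seq X) / R}.
Variables A C : groupType.
Implicit Types (f h : seq A -> chains C) (s : seq A).

(** [f] is null-homotopic in degrees < [N] at the level of the coinvariants,
    by a homotopy of norm at most [K]. Only the coinvariants of [A] and [C]
    are related, not their homogeneous models: this is what allows to
    compare a homomorphism with the trivial one. The constant [K] is
    explicit because it must not depend on the groups. *)
Definition null_homotopic (N : nat) (K : R) f : Prop :=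
  exists h, [/\ h [::] = 0,
    forall a s, coinv (h (translate a s)) = coinv (h s),
    forall s, homog (size s).+1 (h s),
    forall s, (size s <= N)%N ->
      coinv (bd (h s)) + coinv (ext h (bd << s >>)) = coinv (f s) &
    forall s, (size s <= N)%N -> bounded K (h s)].

Lemma null_homotopicB N K K' f f' :
  null_homotopic N K f -> null_homotopic N K' f' ->
  null_homotopic N (K + K') (f \- f').
Proof.
move=> [h [h0 hA hn hf hK]] [h' [h'0 h'A h'n h'f h'K]].
exists (h \- h'); split=> [|a s|s|s sN|s sN] /=.
- by rewrite h0 h'0 subr0.
- by rewrite !linearB /= hA h'A.
- exact: homogB.
- rewrite ext_subfun !linearB /= -hf // -h'f //.
  by rewrite addrACA -opprD.
- exact: boundedB (hK _ sN) (h'K _ sN).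
Qed.

Lemma eq_null_homotopic N K f f' :
    (forall s, (size s <= N)%N -> coinv (f s) = coinv (f' s)) ->
  null_homotopic N K f -> null_homotopic N K f'.
Proof.
move=> ff' [h [h0 hA hn hf hK]]; exists h; split=> // s sN.
by rewrite hf // ff'.
Qed.

(** Recursive norm estimate for [cone_homotopy]: a simplex with n + 1 points
    has n + 1 faces. *)
Definition cone_bound (N : nat) (B : R) : R :=
  iteri N (fun n K => B + n.+1%:R * K) 0.

Section ConeConstruction.
Variables (theta : A -> C) (f : seq A -> chains C).
Hypothesis thetaM : {morph theta : a b / (a * b)%g}.
Hypothesis f0 : f [::] = 0.
Hypothesis f_bd : forall s, bd (f s) = ext f (bd << s >>).
Hypothesis f_homog : forall s, homog (size s) (f s).
Hypothesis f_equiv :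
  forall a s, f (translate a s) = mapc ( *%g (theta a)) (f s).

(** The homogeneous model of [C] is contracted by coning from any vertex.
    Coning the defect [f - h bd] at the image of the first vertex kills it;
    this choice of the vertex is equivariant. The first argument is the size
    of [s], since the recursion goes through the faces of [s]. *)
Fixpoint cone_homotopy_rec n s : chains C :=
  if n is n'.+1 then
    if s is x :: _ then
      cone (theta x) (f s - ext (cone_homotopy_rec n') (bd << s >>))
    else 0
  else 0.

Definition cone_homotopy s := cone_homotopy_rec (size s) s.
Local Notation h := cone_homotopy.

Lemma cone_homotopy_cons x s :
  h (x :: s) = cone (theta x) (f (x :: s) - ext h (bd << x :: s >>)).
Proof.
congr (cone _ (_ - _)); apply: eq_ext_bd => t [st].
by rewrite /h st.
Qed.

Lemma cone_homotopy_bd s : bd (h s) + ext h (bd << s >>) = f s.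
Proof.
have [n] := ubnP (size s); elim: n s => // n IHn [|x s] sn.
  by rewrite /h /= bd_nil !linear0 addr0 f0.
rewrite cone_homotopy_cons bd_cone.
suff -> : bd (f (x :: s) - ext h (bd << x :: s >>)) = 0.
  by rewrite linear0 subr0 subrK.
rewrite linearB /= f_bd (linear_ext_comp (@bd R _)).
rewrite (eq_ext_bd (F := @bd R C \o h)
  (F' := f \- (fun t => ext h (bd << t >>)))); last first.
  by move=> t [ts] /=; rewrite -[f t]IHn ?ts // addrK.
rewrite ext_subfun -[X in _ - (_ - X)]/(ext (ext h \o _) _).
have -> : ext (fun t => ext h (bd << t >>)) (bd << x :: s >>) =
          ext h (bd (bd << x :: s >>)).
  exact/esym/(linear_ext (ext h \o @bd R A)).
by rewrite bd_bd linear0 subr0 subrr.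
Qed.

Lemma cone_homotopy_homog s : homog (size s).+1 (h s).
Proof.
have [n] := ubnP (size s); elim: n s => // n IHn [|x s] sn; first exact: homog0.
rewrite cone_homotopy_cons; apply/homog_cone/homogB => //.
apply: (homog_ext (n := size s)); first exact: homog_bd.
by move=> t ts; rewrite /= -ts; apply: IHn; rewrite ts.
Qed.

Lemma cone_homotopy_equiv a s :
  h (translate a s) = mapc ( *%g (theta a)) (h s).
Proof.
have [n] := ubnP (size s); elim: n s => // n IHn [|x s] sn.
  by rewrite /h /= linear0.
rewrite /= !cone_homotopy_cons mapc_cone -thetaM.
rewrite [mapc _ (_ - _)]linearB /= -f_equiv.
congr (cone _ (_ - _)).
have -> : << (a * x)%g :: translate a s >> =
    mapc ( *%g a) << x :: s >> :> chains A.
  by rewrite mapc_simplex.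
rewrite bd_mapc ext_mapc (linear_ext_comp (mapc ( *%g (theta a)))).
by apply: eq_ext_bd => t [ts] /=; rewrite IHn ?ts.
Qed.

Lemma cone_homotopy_bounded (N : nat) (B : R) : 0 <= B ->
    (forall s, (size s <= N)%N -> bounded B (f s)) ->
  forall s, (size s <= N)%N ->
    bounded (cone_bound N B) (h s).
Proof.
move=> B0; elim: N => [|N IHN] fB s.
  by case: s => // _; rewrite /h /=; exact: bounded0.
case: s => [|x s] sN.
  apply: bounded_le (@bounded0 _ _); rewrite /cone_bound.
  elim: N.+1 => //= n IHn.
  by rewrite addr_ge0 // mulr_ge0.
have hN t : (size t <= N)%N -> bounded (cone_bound N B) (h t).
  by apply: IHN => u uN; apply: fB; exact: leqW.
rewrite cone_homotopy_cons; apply/bounded_cone/boundedB; first exact: fB.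
have K0 := bounded_ge0 (hN [::] (leq0n _)).
apply: (@bounded_le _ _ ((size (x :: s))%:R * cone_bound N B)).
  by rewrite ler_wpM2r // ler_nat.
by apply: bounded_ext_bd => // t [ts]; apply: hN; rewrite ts.
Qed.

(** All comparisons of natural chain maps below are instances of this
    acyclic models argument: a difference of equivariant augmented chain
    maps is null-homotopic in all degrees, with a norm bound that depends
    only on the degree and on the norm of the map. *)
Lemma equivariant_null_homotopic (N : nat) (B : R) :
    (forall s, (size s <= N)%N -> bounded B (f s)) ->
  null_homotopic N (cone_bound N B) f.
Proof.
move=> fB; have B0 := bounded_ge0 (fB [::] (leq0n _)).
exists h; split=> //.
- by move=> a s; rewrite cone_homotopy_equiv coinv_translate.
- exact: cone_homotopy_homog.
- by move=> s _; rewrite -linearD /= cone_homotopy_bd.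
- exact: cone_homotopy_bounded.
Qed.

End ConeConstruction.
End NullHomotopic.

(** * The cross product of chains *)

Section BilinearExtension.
Variables (R : comNzRingType) (K K' : choiceType) (V : lmodType R).
Implicit Types (b : K -> K' -> V).

Definition ext2 b (c : {freeg K / R}) : {freeg K' / R} -> V :=
  fun c' => ext (fun k => ext (b k) c') c.

Lemma ext2_is_linear b c : linear (ext2 b c).
Proof.
move=> a c1 c2.
apply: (@eq_linear _ _ _ (ext (fun k => ext (b k) (a *: c1 + c2)))
  (a \*: ext (fun k => ext (b k) c1) \+ ext (fun k => ext (b k) c2))) => k /=.
by rewrite !ext_basis linearP.
Qed.
HB.instance Definition _ b c := GRing.isLinear.Build R {freeg K' / R} V *:%R
  (ext2 b c) (@ext2_is_linear b c).

Lemma ext2_0l b c' : ext2 b 0 c' = 0.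
Proof. exact: linear0. Qed.

Lemma ext2Dl b c d c' : ext2 b (c + d) c' = ext2 b c c' + ext2 b d c'.
Proof. exact: linearD. Qed.

Lemma ext2Bl b c d c' : ext2 b (c - d) c' = ext2 b c c' - ext2 b d c'.
Proof. exact: linearB. Qed.

Lemma ext2_basis b k k' : ext2 b << k >> << k' >> = b k k'.
Proof. by rewrite /ext2 !ext_basis. Qed.

End BilinearExtension.

Section CrossProduct.
Variable R : comNzRingType.
Local Notation chains X := {freeg (seq X) / R}.
Variables (X Y Z : choiceType) (v : X -> Y -> Z).

(** Signed sum of the monotone lattice paths in the grid of the [v x y]: the
    shuffle map of Eilenberg and Zilber. A path starts at the corner of the
    first vertices, whence a cone. The value at an empty first factor is the
    augmentation of the second one, so that the Leibniz rule [bd_cross] also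
    holds for a product of two points. *)
Fixpoint cross (s : seq X) : seq Y -> chains Z :=
  if s is x :: s' then
    fix cross_s t := if t is y :: t' then
      cone (v x y) (cross s' t + (-1) ^+ size s' *: cross_s t') else 0
  else fun t => if t is [:: _] then << [::] >> else 0.

Arguments cross : simpl never.

Lemma cross_nil s : cross s [::] = 0.
Proof. by case: s. Qed.

Lemma cross_cons x s y t : cross (x :: s) (y :: t) =
  cone (v x y) (cross s (y :: t) + (-1) ^+ size s *: cross (x :: s) t).
Proof. by []. Qed.

(** Leibniz rule. Both sides are expanded along the first vertices: the
    faces that forget the first vertex of both factors occur twice, with
    opposite signs, and the other ones match by induction. *)
Lemma bd_cross s t : bd (cross s t) =
  ext (cross ^~ t) (bd << s >>) - (-1) ^+ size s *: ext (cross s) (bd << t >>).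
Proof.
elim: s t => [t|x s IHs].
  rewrite bd_nil linear0 expr0 scale1r sub0r.
  have -> : bd (cross [::] t) = 0.
    by case: t => [|y [|z t]] /=; rewrite ?bd_nil ?linear0.
  case: t => [|y [|z [|w t]]].
  - by rewrite bd_nil !linear0.
  - by rewrite bd_cons bd_nil linear0 subr0 ext_basis oppr0.
  - rewrite !bd_cons bd_nil linear0 subr0 linearB /= cone_simplex !ext_basis.
    by rewrite subrr oppr0.
  - rewrite (@eq_ext_bd _ _ _ _ (fun=> 0)); last by move=> [|? [|? []]].
    by rewrite ext_cst0 oppr0.
elim=> [|y t IHt].
  rewrite cross_nil bd_nil !linear0 addr0.
  apply/esym; apply: (@eq_linear _ _ _ (ext (cross ^~ [::])) \0) => u /=.
  by rewrite ext_basis cross_nil.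
rewrite cross_cons bd_cone; set e := (-1) ^+ size s.
have crossL : ext (cross ^~ (y :: t)) (cone x (bd << s >>)) =
    cone (v x y) (ext (cross ^~ (y :: t)) (bd << s >>) -
                  e *: ext (fun u => cross (x :: u) t) (bd << s >>)).
  rewrite ext_cone; apply: etrans; last first.
    exact/esym/(linear_ext (cone (v x y) \o
      (ext (cross ^~ (y :: t)) \- (e \*: ext (fun u => cross (x :: u) t))))).
  apply: eq_ext_bd => u us /=; rewrite !ext_basis cross_cons; congr (cone _ _).
  by rewrite /e -us exprS mulN1r scaleNr opprK.
have crossR : ext (cross (x :: s)) (cone y (bd << t >>)) =
    cone (v x y) (ext (cross s) (cone y (bd << t >>)) +
                  e *: ext (cross (x :: s)) (bd << t >>)).
  rewrite !ext_cone; apply: etrans; last first.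
    exact/esym/(linear_ext (cone (v x y) \o
      (ext (fun w => cross s (y :: w)) \+ (e \*: ext (cross (x :: s)))))).
  by apply: eq_ext => w /=; rewrite !ext_basis cross_cons.
have eS : (-1) ^+ size (x :: s) = - e by rewrite exprS mulN1r.
have -> : bd (cross s (y :: t) + e *: cross (x :: s) t) =
    ext (cross ^~ (y :: t)) (bd << s >>) -
      e *: ext (fun u => cross (x :: u) t) (bd << s >>) +
    e *: (ext (cross s) (cone y (bd << t >>)) +
          e *: ext (cross (x :: s)) (bd << t >>)).
  rewrite linearD linearZ /= IHs IHt eS !bd_cons.
  rewrite (linearB (ext (cross s))) (linearB (ext (cross ^~ t))) /=.
  rewrite !ext_basis (ext_cone (cross ^~ t)).
  apply/eqP/freeg_eqP=> z; rewrite !(coeffD, coeffN, coeffZ).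
  rewrite -/e; ring.
rewrite eS !bd_cons (linearB (ext (cross ^~ (y :: t)))).
rewrite (linearB (ext (cross (x :: s)))) /= !ext_basis crossL crossR.
rewrite [cone _ (_ + e *: (_ + _))]linearD /= [cone _ (e *: _)]linearZ /=.
apply/eqP/freeg_eqP=> z; rewrite !(coeffD, coeffN, coeffZ); ring.
Qed.

End CrossProduct.

Arguments cross : simpl never.

Section CrossProductTheory.
Variable R : comNzRingType.
Local Notation chains X := {freeg (seq X) / R}.

Lemma bd_ext2_cross (X Y Z : choiceType) (v : X -> Y -> Z) n
    (c : chains X) (c' : chains Y) : homog n c ->
  bd (ext2 (cross R v) c c') =
  ext2 (cross R v) (bd c) c' - (-1) ^+ n *: ext2 (cross R v) c (bd c').
Proof.
move=> cn; pose crossl (d : chains Y) := ext (fun s => ext (cross R v s) d).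
rewrite [LHS]linear_ext_comp.
apply: etrans; last exact/esym/(linear_ext
  ((crossl c' \o @bd R X) \- ((-1) ^+ n \*: crossl (bd c')))).
apply: (eq_ext_homog cn) => s sn /=.
rewrite /crossl ext_basis.
apply: (@eq_linear _ _ _ (@bd R Z \o ext (cross R v s))
  (ext2 (cross R v) (bd << s >>) \-
     ((-1) ^+ n \*: (ext (cross R v s) \o @bd R Y))))
  => t /=; rewrite ext_basis bd_cross sn; congr (_ - _).
by apply: eq_ext => u; rewrite ext_basis.
Qed.

Lemma cross_map (X X' Y Y' Z : choiceType) (f : X' -> X) (g : Y' -> Y)
    (v : X -> Y -> Z) s t :
  cross R v (map f s) (map g t) = cross R (fun x y => v (f x) (g y)) s t.
Proof.
elim: s t => [|x s IHs] t; first by case: t => [|? []].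
elim: t => [|y t IHt]; first by [].
by rewrite /= !cross_cons -IHt -IHs size_map.
Qed.

Lemma mapc_cross (X Y Z Z' : choiceType) (v : X -> Y -> Z) (f : Z -> Z') s t :
  mapc f (cross R v s t) = cross R (fun x y => f (v x y)) s t.
Proof.
elim: s t => [|x s IHs].
  by case=> [|? [|? ?]]; [exact: linear0|exact: mapc_simplex|exact: linear0].
elim=> [|y t IHt]; first by rewrite !cross_nil linear0.
by rewrite !cross_cons mapc_cone linearD linearZ /= IHt IHs.
Qed.

(** For such a [v] a translation of either factor translates the cross
    product, so that the cross product descends to the coinvariants. *)
Lemma coinv_ext2_cross (A B C : groupType) (v : A -> B -> C) c c' :
    (forall a b x y, v (a * x)%g (b * y)%g = (v a b * v x y)%g) ->
  coinv (ext2 (cross R v) (coinv c) (coinv c')) = coinv (ext2 (cross R v) c c').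
Proof.
move=> vM; pose crossl (d : chains B) := ext (fun s => ext (cross R v s) d).
apply: (@eq_linear _ _ _ (@coinv R C \o (crossl (coinv c') \o @coinv R A))
  (@coinv R C \o crossl c')) => s /=.
rewrite coinv_simplex /crossl !ext_basis.
apply: (@eq_linear _ _ _
  (@coinv R C \o (ext (cross R v (rebase s)) \o @coinv R B))
  (@coinv R C \o ext (cross R v s))) => t /=.
rewrite coinv_simplex !ext_basis /rebase /translate cross_map.
rewrite (_ : (fun x y => _) =
  fun x y => (v (head 1 s)^-1 (head 1 t)^-1 * v x y)%g)%g.
  by rewrite -(mapc_cross v) coinv_translate.
by apply/funext => x; apply/funext => y; rewrite vM.
Qed.

Lemma homog_cross (X Y Z : choiceType) (v : X -> Y -> Z) n s t :
  (size s + size t)%N = n.+1 -> homog n (cross R v s t).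
Proof.
elim: s t n => [|x s IHs].
  case=> [|y [|z t]] n //= stn; last exact: homog0.
  by case: stn => <-; exact: (homog_simplex _ [::]).
elim=> [|y t IHt] n stn; first by rewrite cross_nil; exact: homog0.
move: stn; rewrite cross_cons /= addSn addnS => -[<-].
apply/homog_cone/homogD; first by apply: IHs; rewrite /= addnS.
by apply/homogZ/IHt.
Qed.

Lemma homog_ext2_cross (X Y Z : choiceType) (v : X -> Y -> Z) p q n c c' :
    homog p c -> homog q c' -> (p + q)%N = n.+1 ->
  homog n (ext2 (cross R v) c c').
Proof.
move=> cp c'q pqn; apply: (homog_ext cp) => s sp.
by apply: (homog_ext c'q) => t tq; apply: homog_cross; rewrite sp tq.
Qed.

End CrossProductTheory.

Lemma bounded_cross (R : numDomainType) (X Y Z : choiceType) (v : X -> Y -> Z)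
    s t :
  bounded (2 ^+ (size s + size t)) (cross R v s t).
Proof.
have ge0 n : 0 <= 2 ^+ n :> R by rewrite exprn_ge0.
have ge1 n : 1 <= 2 ^+ n :> R by rewrite exprn_ege1 // ler1n.
elim: s t => [|x s IHs].
  case=> [|y [|z t]]; first exact: bounded_le (ge0 _) (@bounded0 R _).
    exact: bounded_le (ge1 _) (@bounded_simplex R Z [::]).
  exact: bounded_le (ge0 _) (@bounded0 R _).
elim=> [|y t IHt].
  by rewrite cross_nil; exact: bounded_le (ge0 _) (@bounded0 R _).
rewrite cross_cons /= addSn exprS mulr_natl mulr2n.
apply: bounded_cone; apply: boundedD; first exact: IHs.
by apply: bounded_sign; move: IHt; rewrite addnS.
Qed.

Lemma bounded_ext2_cross (R : numDomainType) (X Y Z : choiceType)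
    (v : X -> Y -> Z) p q (B B' : R) c c' :
    homog p c -> bounded B c -> homog q c' -> bounded B' c' ->
  bounded (B * (B' * 2 ^+ (p + q))) (ext2 (cross R v) c c').
Proof.
move=> cp cB c'q c'B; have pq0 : 0 <= 2 ^+ (p + q) :> R by rewrite exprn_ge0.
apply: (bounded_ext_homog cp cB) => [|s sp].
  by rewrite mulr_ge0 // (bounded_ge0 c'B).
apply: (bounded_ext_homog c'q c'B) => // t tq.
by rewrite -sp -tq; exact: bounded_cross.
Qed.

(** * Front and back faces *)

Section Splits.
Variables (R : comNzRingType) (X : choiceType).
Local Notation chains X := {freeg (seq X) / R}.

(** Sum of [b (x_0 .. x_p) (x_p .. x_n)] over p: the diagonal approximation
    of Alexander and Whitney, composed with [b]. *)
Fixpoint splits (V : zmodType) (b : seq X -> seq X -> V) (s : seq X) : V :=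
  if s is x :: s' then b [:: x] s + splits (fun u w => b (x :: u) w) s' else 0.

Lemma splits_additive (V W : zmodType) (g : {additive V -> W}) b s :
  g (splits b s) = splits (fun u w => g (b u w)) s.
Proof.
by elim: s b => [|x s IHs] b; rewrite /= ?raddf0 // raddfD /= IHs.
Qed.

Lemma splitsD (V : zmodType) (b b' : seq X -> seq X -> V) s :
  splits (fun u w => b u w + b' u w) s = splits b s + splits b' s.
Proof.
elim: s b b' => [|x s IHs] b b' /=; first by rewrite addr0.
by rewrite IHs addrACA.
Qed.

Lemma splitsB (V : zmodType) (b b' : seq X -> seq X -> V) s :
  splits (fun u w => b u w - b' u w) s = splits b s - splits b' s.
Proof.
by rewrite splitsD -(splits_additive (-%R)).
Qed.

Lemma eq_splits (V : zmodType) (b b' : seq X -> seq X -> V) s :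
    (forall u w, (size u + size w)%N = (size s).+1 -> (0 < size w)%N ->
      b u w = b' u w) ->
  splits b s = splits b' s.
Proof.
elim: s b b' => [//|x s IHs] b b' bb' /=; rewrite bb' //; congr (_ + _).
by apply: IHs => u w uw w0; apply: bb'; rewrite //= addSn uw.
Qed.

Lemma splits_map (V : zmodType) (f : X -> X) (b : seq X -> seq X -> V) s :
  splits b (map f s) = splits (fun u w => b (map f u) (map f w)) s.
Proof. by elim: s b => [|x s IHs] b //=; rewrite IHs. Qed.

(** The Alexander-Whitney map is a chain map: the last face of a front
    cancels with the first face of the previous back. In the augmented
    complex, the two extreme terms survive. *)
Lemma splits_bd (V : lmodType R) (b : seq X -> seq X -> V) s :
  splits (fun u w => ext (b ^~ w) (bd << u >>) -
                     (-1) ^+ size u *: ext (b u) (bd << w >>)) s =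
  ext (splits b) (bd << s >>) + b [::] s - (-1) ^+ size s *: b s [::].
Proof.
elim: s b => [|x s IHs] b /=.
  by rewrite bd_nil linear0 add0r expr0 scale1r subrr.
rewrite bd_cons bd_nil linear0 subr0 ext_basis expr1 scaleN1r opprK.
pose bx u w := b (x :: u) w.
rewrite (_ : splits _ s = splits (fun u w => b u w -
    (ext (bx ^~ w) (bd << u >>) -
     (-1) ^+ size u *: ext (bx u) (bd << w >>))) s).
  rewrite splitsB IHs bd_cons !linearB /= !ext_basis !ext_cone /bx.
  have -> : ext (fun t => splits b (x :: t)) (bd << s >>) =
      ext (fun t => b [:: x] (x :: t)) (bd << s >>) +
      ext (splits bx) (bd << s >>).
    exact: ext_addfun.
  rewrite exprS mulN1r scaleNr !opprK !opprD !addrA.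
  by rewrite [LHS](ACl (2*6*(4*3*5*1*7)))%AC /= subrr add0r.
apply: eq_splits => u w _ _.
rewrite bd_cons linearB /= ext_basis ext_cone exprS mulN1r scaleNr !opprK.
by rewrite opprD opprK addrA.
Qed.

Lemma homog_splits (Y : choiceType) n (b : seq X -> seq X -> chains Y) s :
    (forall u w, (size u + size w)%N = (size s).+1 -> homog n (b u w)) ->
  homog n (splits b s).
Proof.
elim: s b => [|x s IHs] b bn /=; first exact: homog0.
apply: homogD; first exact: bn.
by apply: IHs => u w uw; apply: bn; rewrite /= addSn uw.
Qed.

End Splits.

Lemma bounded_splits (R : numDomainType) (X Y : choiceType) B
    (b : seq X -> seq X -> {freeg (seq Y) / R}) s :
    (forall u w, (size u + size w)%N = (size s).+1 -> (0 < size w)%N ->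
      bounded B (b u w)) ->
  bounded ((size s)%:R * B) (splits b s).
Proof.
elim: s b => [|x s IHs] b bB /=; first by rewrite mul0r; exact: bounded0.
rewrite mulrSr addrC mulrDl mul1r; apply: boundedD; first exact: bB.
by apply: IHs => u w uw w0; apply: bB; rewrite //= addSn uw.
Qed.

(** * Null-homotopies in a mitosis *)

Section NullHomotopies.
Variable R : numDomainType.
Local Notation chains X := {freeg (seq X) / R}.

(** The extreme term of [splits_bd] makes this a chain map only up to the
    augmentation; adding the empty simplex in degree -1 corrects it. *)
Lemma bd_splits_cross (X Z : choiceType) (v : X -> X -> Z) s :
  bd (splits (cross R v) s) =
  ext (splits (cross R v)) (bd << s >>) +
  (if s is [:: _] then << [::] >> else 0).
Proof.
rewrite (splits_additive (@bd R Z)).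
rewrite (_ : splits _ s = splits (fun u w => ext (cross R v ^~ w) (bd << u >>) -
    (-1) ^+ size u *: ext (cross R v u) (bd << w >>)) s); last first.
  by apply: eq_splits => u w _ _ /=; rewrite bd_cross.
by rewrite splits_bd cross_nil scaler0 subr0.
Qed.

(** Eilenberg-Zilber: the shuffles of the fronts and backs are homotopic to
    the diagonal, as both are equivariant chain maps. *)
Lemma diagonal_null_homotopic (A C : groupType) (v : A -> A -> C) N :
    (forall a b x y, v (a * x)%g (b * y)%g = (v a b * v x y)%g) ->
  null_homotopic N (cone_bound N (N%:R * 2 ^+ N.+1 + 1 + 1)) (fun s =>
    splits (cross R v) s + (if s is [::] then << [::] >> else 0)
    - << [seq v x x | x <- s] >>).
Proof.
move=> vM.
pose aug (s : seq A) : chains C := if s is [::] then << [::] >> else 0.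
apply: (equivariant_null_homotopic (theta := fun a => v a a)).
- by move=> a b; rewrite vM.
- by rewrite /= add0r subrr.
- move=> s.
  rewrite ext_subfun -/(mapc _) !linearB /= -mapc_simplex bd_mapc.
  congr (_ - _).
  have -> : ext (fun s => splits (cross R v) s + aug s) (bd << s >>) =
      ext (splits (cross R v)) (bd << s >>) + ext aug (bd << s >>).
    exact: ext_addfun.
  rewrite linearD /= bd_splits_cross -addrA; congr (_ + _).
  case: s => [|x s]; first by rewrite !bd_nil !linear0 addr0.
  rewrite linear0 addr0 bd_cons linearB /= ext_basis ext_cone.
  rewrite (eq_ext (F' := fun=> 0)) // ext_cst0 subr0.
  by case: s.
- move=> s; apply: homogB; last first.
    by rewrite -(size_map (fun x => v x x)); exact: homog_simplex.
  apply: homogD; last first.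
    by case: s => [|x s]; [exact: (homog_simplex _ [::])|exact: homog0].
  by apply: homog_splits => u w; exact: homog_cross.
- move=> a s; rewrite linearB linearD /= mapc_simplex -!map_comp.
  congr (_ + _ - << _ >>); last by apply: eq_map => x; rewrite /= vM.
    rewrite /translate splits_map (splits_additive (mapc _)).
    apply: eq_splits => u w _ _ /=.
    rewrite cross_map mapc_cross; congr (cross R _ u w).
    by apply/funext => x; apply/funext => y; rewrite vM.
  by case: s => [|x s]; rewrite ?linear0 //= mapc_simplex.
- move=> s sN; apply: boundedB; last exact: bounded_simplex.
  apply: boundedD; last first.
    case: s {sN} => [|x s]; first exact: bounded_simplex.
    by apply: bounded_le _ (@bounded0 R _); rewrite ler01.
  have p2 n : 0 <= 2 ^+ n :> R by rewrite exprn_ge0.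
  apply: (@bounded_le _ _ ((size s)%:R * 2 ^+ N.+1)).
    by rewrite ler_wpM2r // ler_nat.
  apply: bounded_splits => u w uw _; apply: bounded_le _ (bounded_cross v u w).
  by rewrite uw ler_weXn2l // ler1n.
Qed.

(** Inner automorphisms act trivially on homology: in the coinvariants, left
    multiplication by [c] disappears, and right multiplication by the
    inverse of [c] is an equivariant chain map, hence homotopic to [phi]. *)
Lemma conj_null_homotopic (A C : groupType) (phi : A -> C) (c : C) N :
    {morph phi : a b / (a * b)%g} ->
  null_homotopic N (cone_bound N (1 + 1))
    (fun s =>
       << [seq lconj (phi x) c | x <- s] >> - << map phi s >> : chains C).
Proof.
move=> phiM.
(* Right translations commute with the left translations by [A]. *)
have right_null : null_homotopic N (cone_bound N (1 + 1))
    (fun s => << [seq phi x * c^-1 | x <- s]%g >> - << map phi s >> : chains C).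
  apply: (equivariant_null_homotopic (theta := phi)).
  - by [].
  - by rewrite subrr.
  - move=> s; rewrite ext_subfun linearB /= -!mapc_simplex !bd_mapc.
    by rewrite -!/(mapc _ _).
  - by move=> s; apply: homogB; exact: homog_map.
  - move=> a s; rewrite linearB /= !mapc_simplex -!map_comp.
    by congr (<< _ >> - << _ >>); apply: eq_map => x /=; rewrite phiM ?mulgA.
  - by move=> s _; apply: boundedB; exact: bounded_simplex.
apply: eq_null_homotopic right_null => s _; rewrite !linearB /=; congr (_ - _).
rewrite -(coinv_translate c) mapc_simplex -map_comp; congr (coinv << _ >>).
by apply: eq_map => x /=; rewrite mulgA.
Qed.

(** Subtracting the trivial homomorphism makes this chain map vanish on
    points in the coinvariants ([coinv_reduced_map1]), which is where a
    degree is gained in [cross_reduced_null_homotopic]. *)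
Definition reduced_map (A B : groupType) (phi : A -> B) (s : seq A) :
    chains B :=
  << map phi s >> - << map (fun=> 1%g) s >>.

Section ReducedMap.
Variables (A B : groupType) (phi : A -> B).
Hypothesis phiM : {morph phi : a b / (a * b)%g}.
Local Notation eta := (reduced_map phi).

Lemma reduced_map_nil : eta [::] = 0.
Proof. exact: subrr. Qed.

Lemma homog_reduced_map s : homog (size s) (eta s).
Proof. by apply: homogB; exact: homog_map. Qed.

Lemma bounded_reduced_map s : bounded (1 + 1) (eta s).
Proof. by apply: boundedB; exact: bounded_simplex. Qed.

Lemma bd_reduced_map s : bd (eta s) = ext eta (bd << s >>).
Proof. by rewrite ext_subfun linearB /= -!mapc_simplex !bd_mapc. Qed.

Lemma coinv_reduced_map_translate a s :
  coinv (eta (translate a s)) = coinv (eta s).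
Proof.
rewrite !linearB /= -!map_comp; congr (_ - _).
rewrite -(coinv_translate (phi a) << map phi s >>) mapc_simplex -map_comp.
by congr (coinv << _ >>); apply: eq_map => x /=; rewrite phiM.
Qed.

Lemma coinv_reduced_map1 x : coinv (eta [:: x]) = 0.
Proof.
by rewrite linearB /= !coinv_simplex /rebase /= !mulVg subrr.
Qed.

End ReducedMap.

Section CrossReduced.
Variables (A B C : groupType) (phi : A -> B) (v : B -> B -> C).
Hypothesis phiM : {morph phi : a b / (a * b)%g}.
Hypothesis vM : forall a b x y, v (a * x)%g (b * y)%g = (v a b * v x y)%g.
Local Notation eta := (reduced_map phi).

(** The square of [eta] for the cross product, evaluated on the diagonal of
    [A]. *)
Definition cross_reduced s : chains C :=
  splits (fun u w => ext2 (cross R v) (eta u) (eta w)) s.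

(** If [h] contracts [eta], then [h] crossed with [eta] contracts the square
    [cross_reduced] of [eta]. One degree is gained: [eta] vanishes on a back
    of degree 0, and the other splittings of a simplex have a front of
    smaller degree. *)
Lemma cross_reduced_null_homotopic N K :
    null_homotopic N K eta ->
  null_homotopic N.+1 (N.+1%:R * (K * ((1 + 1) * 2 ^+ N.+3))) cross_reduced.
Proof.
move=> [h [h0 hA hn heta hK]].
pose b u w := coinv (ext2 (cross R v) (h u) (eta w)).
have b_coinv u w :
    b u w = coinv (ext2 (cross R v) (coinv (h u)) (coinv (eta w))).
  by rewrite coinv_ext2_cross.
have b1 u x : b u [:: x] = 0 by rewrite b_coinv coinv_reduced_map1 !linear0.
have b0 u : b u [::] = 0 by rewrite /b reduced_map_nil !linear0.
exists (splits b); split=> [//|a s|s|s sN|s sN].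
- rewrite /translate splits_map; congr (coinv _); apply: eq_splits => u w _ _.
  by rewrite !b_coinv hA coinv_reduced_map_translate.
- apply: homog_splits => u w uw; apply: homog_coinv.
  apply: (homog_ext2_cross v (hn u) (homog_reduced_map phi w)).
  by rewrite addSn uw.
- have -> : ext (splits b) (bd << s >>) = splits (fun u w =>
      ext (b ^~ w) (bd << u >>) - (-1) ^+ size u *: ext (b u) (bd << w >>)) s.
    rewrite splits_bd b0 scaler0 subr0 [b [::] s]/b h0.
    by rewrite ext2_0l linear0 addr0.
  rewrite -linearD /= (splits_additive (@bd R C)) -splitsD.
  rewrite /cross_reduced !(splits_additive (@coinv R C)).
  apply: eq_splits => u w uw w0 /=; rewrite linearD linearB linearZ /=.
  case: w uw w0 => [//|x [|y w]] uw _.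
    (* The back is a point: every term vanishes. *)
    rewrite b1 bd_cons bd_nil !linear0 !addr0 ext_basis b0.
    rewrite (eq_ext (b1 ^~ x)) ext_cst0 -[RHS]coinv_ext2_cross //.
    by rewrite coinv_reduced_map1 !linear0 !addr0.
  (* The back has at least two points, so [heta] applies to the front. *)
  have uN : (size u <= N)%N by move: uw => /=; lia.
  have extL c : ext (b ^~ (x :: y :: w)) c =
      coinv (ext2 (cross R v) (ext h c) (eta (x :: y :: w))).
    apply: (@eq_linear _ _ _ (ext (b ^~ (x :: y :: w))) (@coinv R C \o
      (ext (fun s => ext (cross R v s) (eta (x :: y :: w))) \o ext h))) => t /=.
    by rewrite !ext_basis.
  have extR c : ext (b u) c = coinv (ext2 (cross R v) (h u) (ext eta c)).
    apply: (@eq_linear _ _ _ (ext (b u))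
      (@coinv R C \o (ext2 (cross R v) (h u) \o ext eta))) => t /=.
    by rewrite !ext_basis.
  rewrite extL extR !coinv_id /b coinv_bd (bd_ext2_cross _ _ (hn u)).
  rewrite bd_reduced_map.
  rewrite -[RHS]coinv_ext2_cross // -heta // -linearD /= coinv_ext2_cross //.
  rewrite ext2Dl.
  move: (ext2 _ (bd (h u)) _) (ext2 _ (ext h _) _) (ext2 _ (h u) _) => p r q.
  rewrite exprS mulN1r scaleNr opprK !linearD linearZ /=.
  by rewrite addrACA subrr addr0.
- have K0 := bounded_ge0 (hK [::] (leq0n _)).
  have p0 n : 0 <= 2 ^+ n :> R by rewrite exprn_ge0.
  have B0 : 0 <= K * ((1 + 1) * 2 ^+ N.+3).
    by apply: mulr_ge0 => //; exact: mulr_ge0.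
  apply: (@bounded_le _ _ ((size s)%:R * (K * ((1 + 1) * 2 ^+ N.+3)))).
    by rewrite ler_wpM2r // ler_nat.
  apply: bounded_splits => u w uw w0.
  case: w uw w0 => [//|x [|y w]] uw _.
    by rewrite b1; exact: bounded_le B0 (@bounded0 R _).
  have uN : (size u <= N)%N by move: uw sN => /=; lia.
  apply: bounded_coinv.
  apply: bounded_le _ (bounded_ext2_cross v (hn u) (hK u uN)
    (homog_reduced_map phi _) (bounded_reduced_map phi _)).
  rewrite !ler_wpM2l // ?addr_ge0 // ler_weXn2l ?ler1n //.
  by move: uw sN => /=; lia.
Qed.

End CrossReduced.
End NullHomotopies.

Section MitosisStep.
Variable R : numDomainType.
Local Notation chains X := {freeg (seq X) / R}.

(** Let [i] be [psi \o phi]. Expanding the square of [eta] in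
    [cross_reduced_null_homotopic] by bilinearity, and applying
    Eilenberg-Zilber to each of the four terms, gives a null-homotopy of
    [i^d - i - i^s + 1], where [i * i^s = i^d] on the diagonal. As [i^d] and
    [i^s] are homotopic to [i], this leaves a null-homotopy of [i - 1]. *)
Lemma mitosis_null_homotopic N (K : R) :
  exists K' : R,
  forall (A B C : groupType) (phi : A -> B) (psi : B -> C) (s d : C),
    {morph phi : a b / (a * b)%g} -> {morph psi : a b / (a * b)%g} ->
    (forall b, lconj (psi b) d = psi b * lconj (psi b) s)%g ->
    (forall b b', commute (psi b) (lconj (psi b') s)) ->
    null_homotopic N K (reduced_map R phi) ->
    null_homotopic N.+1 K' (reduced_map R (psi \o phi)).
Proof.
eexists => A B C phi psi s d phiM psiM dbl comm phi_null.
have psi1 : psi 1%g = 1%g.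
  by apply: (mulgI (psi 1%g)); rewrite -psiM !mulg1.
have lconjM x y : lconj (x * y)%g s = (lconj x s * lconj y s)%g.
  by rewrite /lconj -!mulgA mulKg.
have lconj1 : lconj 1%g s = 1%g by rewrite /lconj mulg1 mulgV.
pose v b b' := (psi b * lconj (psi b') s)%g.
have vM a b x y : v (a * x)%g (b * y)%g = (v a b * v x y)%g.
  rewrite /v !psiM lconjM; move: (comm x b).
  move: (lconj (psi b) s) (lconj (psi y) s) => lb ly xb.
  by rewrite !mulgA -(mulgA (psi a)) xb mulgA.
pose triv (a : A) : B := 1%g.
have trivM : {morph triv : a b / (a * b)%g} by move=> a b; rewrite /triv mulg1.
pose w (f g : A -> B) (x y : A) := v (f x) (g y).
have diag_null f g (fM : {morph f : x y / (x * y)%g})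
    (gM : {morph g : x y / (x * y)%g}) :=
  @diagonal_null_homotopic R A C (w f g) N.+1
    (fun a b x y => etrans (congr2 v (fM a x) (gM b y)) (vM _ _ _ _)).
(* The empty simplices added in degree -1 cancel in this alternating sum. *)
have := null_homotopicB
  (null_homotopicB (diag_null _ _ phiM phiM) (diag_null _ _ phiM trivM))
  (null_homotopicB (diag_null _ _ trivM phiM) (diag_null _ _ trivM trivM)).
move/(null_homotopicB (cross_reduced_null_homotopic phiM vM phi_null)).
move/(null_homotopicB (conj_null_homotopic R d N.+1 (phi := psi \o phi) _)).
move=> /(_ (fun a b => etrans (congr1 psi (phiM a b)) (psiM _ _))).
move/null_homotopicB => /(_ _ _
  (conj_null_homotopic R s N.+1
     (fun a b => etrans (congr1 psi (phiM a b)) (psiM _ _)))).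
apply: eq_null_homotopic => t _; congr coinv => /=.
have -> : cross_reduced R phi v t =
    splits (cross R (w phi phi)) t - splits (cross R (w phi triv)) t -
    (splits (cross R (w triv phi)) t - splits (cross R (w triv triv)) t).
  rewrite -!splitsB; apply: eq_splits => u u' _ _.
  by rewrite ext2Bl !linearB /= !ext2_basis !cross_map.
have -> : [seq w phi phi x x | x <- t] =
    [seq lconj ((psi \o phi) x) d | x <- t].
  by apply: eq_map => x; rewrite /= dbl.
have -> : [seq w phi triv x x | x <- t] = map (psi \o phi) t.
  by apply: eq_map => x; rewrite /w /v /triv psi1 lconj1 mulg1.
have -> : [seq w triv phi x x | x <- t] =
    [seq lconj ((psi \o phi) x) s | x <- t].
  by apply: eq_map => x; rewrite /w /v /triv psi1 mul1g.
have -> : [seq w triv triv x x | x <- t] = map (fun=> 1%g) t.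
  by apply: eq_map => x; rewrite /w /v /triv psi1 lconj1 mulg1.
rewrite /reduced_map.
move: (if t is [::] then _ else _) => z0.
move: (splits _ _) (splits _ _) (splits _ _) (splits _ _) => z1 z2 z3 z4.
apply/eqP/freeg_eqP=> z; rewrite !(coeffD, coeffN); ring.
Qed.

End MitosisStep.

(** * Finitely generated subgroups of a mitotic group *)

Section SubgroupType.
Variables (G : groupType) (H : set G).

Definition subgroup_type (HG : subgroup H) : Type := {x : G | x \in H}.

Variable HG : subgroup H.
HB.instance Definition _ := SubType.on (subgroup_type HG).
HB.instance Definition _ := Choice.on (subgroup_type HG).
HB.instance Definition _ :=
  SubChoice_isSubGroup.Build G [in H] (subgroup_type HG) HG.

End SubgroupType.

Section Generated.
Variable G : groupType.
Implicit Types S T K : set G.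

Lemma subgroup_generated S : subgroup (generated S).
Proof.
split=> [|x y]; rewrite !inE.
  by move=> K [[K1 _] _]; move: K1; rewrite !inE.
move=> Sx Sy K KS; have [[_ Kdiv] _] := KS.
have := Kdiv x y; rewrite !inE; apply; [exact: Sx|exact: Sy].
Qed.

End Generated.

Section MitoticGroup.
Variables (R : numDomainType) (G : groupType).
Implicit Types H K S : set G.

Lemma generatedU_generated S T :
  generated (generated S `|` T) = generated (S `|` T).
Proof.
apply/seteqP; split; apply: smallest_sub; try exact: subgroup_generated.
  move=> x [Sx|Tx]; last by apply: sub_gen_smallest; right.
  move: x Sx; apply: smallest_sub; first exact: subgroup_generated.
  by move=> x Sx; apply: sub_gen_smallest; left.
move=> x [Sx|Tx]; apply: sub_gen_smallest; last by right.
by left; apply: sub_gen_smallest.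
Qed.

Lemma mitosis_finitely_generated H K :
  finitely_generated H -> mitosis H K -> finitely_generated K.
Proof.
move=> [S Sfin ->] [s [d [_ _ -> _ _]]]; exists (S `|` [set s; d]).
  by rewrite finite_setU; split=> //; rewrite finite_setU; split.
exact: generatedU_generated.
Qed.

Lemma val_subgroupM H (HG : subgroup H) :
  {morph (val : subgroup_type HG -> G) : x y / (x * y)%g}.
Proof. exact: valM. Qed.

Hypothesis G_mitotic : mitotic G.

(** Induction on the degree, with one mitosis for each degree. The constant
    is chosen before the subgroup: its uniformity is what a limit over all
    the finitely generated subgroups requires. *)
Lemma mitotic_null_homotopic N : exists K : R, forall H (HG : subgroup H),
    finitely_generated H ->
  exists (L : set G) (LG : subgroup L)
      (phi : subgroup_type HG -> subgroup_type LG),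
    [/\ finitely_generated L, forall x, val (phi x) = val x &
        null_homotopic N K (reduced_map R phi)].
Proof.
elim: N => [|N [K IHN]].
  exists 0 => H HG Hfg; exists H, HG, id; split=> //.
  exists (fun=> 0); split=> [//|//|s|[|//] _|s _]; first exact: homog0.
    by rewrite reduced_map_nil bd_nil !linear0 addr0.
  exact: bounded0.
have [K' stepK] := @mitosis_null_homotopic R N K.
exists K' => H HG Hfg.
have [L [LG [phi [Lfg valphi phi_null]]]] := IHN H HG Hfg.
have [M [MG LM LmM]] := G_mitotic LG Lfg.
have [s [d [Ms Md _ dbl comm]]] := LmM.
have psiP (x : subgroup_type LG) : val x \in M.
  by apply/mem_set/LM/set_mem/valP.
pose psi (x : subgroup_type LG) : subgroup_type MG := Sub (val x) (psiP x).
exists M, MG, (psi \o phi); split.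
- exact: mitosis_finitely_generated LmM.
- by move=> x; rewrite -[RHS]valphi.
- have valV (x : subgroup_type MG) : val x^-1%g = (val x)^-1%g.
    by apply: (mulgI (val x)); rewrite -val_subgroupM !mulgV.
  pose s' : subgroup_type MG := Sub s (mem_set Ms).
  pose d' : subgroup_type MG := Sub d (mem_set Md).
  apply: (stepK _ _ _ phi psi s' d') => //.
  + by move=> x y; apply: val_inj; rewrite val_subgroupM !valphi val_subgroupM.
  + by move=> x y; apply: val_inj; rewrite val_subgroupM; exact: val_subgroupM.
  + move=> b; apply: val_inj; rewrite /lconj !val_subgroupM !valV.
    by apply: dbl; exact: set_mem (valP b).
  + move=> b b'; apply: val_inj; rewrite /lconj !val_subgroupM !valV.
    apply/commgP/eqP/comm; first exact: set_mem (valP b').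
    exact: set_mem (valP b).
Qed.

Lemma mitotic_inclusion_null_homotopic N : exists K : R,
  forall H (HG : subgroup H), finitely_generated H ->
    null_homotopic N K (reduced_map R (val : subgroup_type HG -> G)).
Proof.
have [K0 nullK] := mitotic_null_homotopic N.
have [K' stepK] := @mitosis_null_homotopic R N K0.
exists K' => H HG Hfg.
have [L [LG [phi [Lfg valphi phi_null]]]] := nullK H HG Hfg.
have [M [MG LM [s [d [_ _ _ dbl comm]]]]] := G_mitotic LG Lfg.
have : null_homotopic N.+1 K' (reduced_map R (val \o phi)).
  apply: (stepK _ _ _ phi (val : subgroup_type LG -> G) s d) => //.
  - by move=> x y; apply: val_inj; rewrite val_subgroupM !valphi val_subgroupM.
  - by move=> b; apply: dbl; exact: set_mem (valP b).
  - move=> b b'; apply/commgP/eqP/comm; first exact: set_mem (valP b').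
    exact: set_mem (valP b).
rewrite (_ : val \o phi = val); last exact/funext.
move=> [h [h0 hA hn hf hK]]; exists h.
by split=> // t tN; [apply: hf|apply: hK]; exact: leqW.
Qed.

End MitoticGroup.

(** * Homogeneous and inhomogeneous cochains *)

Section Faces.
Variable R : comNzRingType.

Definition face (X : Type) i (s : seq X) : seq X := take i s ++ drop i.+1 s.

Lemma bd_faces (X : choiceType) (s : seq X) :
  bd << s >> =
  \sum_(i < size s) (-1) ^+ i *: << face i s >> :> {freeg (seq X) / R}.
Proof.
elim: s => [|x s IHs]; first by rewrite big_ord0 bd_nil.
rewrite bd_cons IHs big_ord_recl /face /= ?take0 ?drop0 expr0 scale1r.
congr (_ + _).
rewrite linear_sum -sumrN; apply: eq_bigr => i _.
by rewrite linearZ /= cone_simplex exprS mulN1r scaleNr.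
Qed.

Lemma nth_face (X : Type) (x0 : X) i s j : (i < size s)%N ->
  nth x0 (face i s) j = nth x0 s (bump i j).
Proof.
move=> si; rewrite /face nth_cat size_takel ?(ltnW si) // /bump.
case: (ltnP j i) => [ji|ij]; first by rewrite nth_take.
by rewrite nth_drop add1n addSn subnKC.
Qed.

Lemma size_face (X : Type) i (s : seq X) : (i < size s)%N ->
  size (face i s) = (size s).-1.
Proof. by move=> si; rewrite size_cat size_takel ?size_drop; lia. Qed.

End Faces.

Section Bar.
Variables (R : realType) (G : groupType).
Local Notation chains X := {freeg (seq X) / R}.

(** The bar notation for the orbit of a homogeneous simplex: the quotients
    of its successive vertices. [unbar] is the representative with first
    vertex 1. *)
Definition bar k (s : seq G) : k.-tuple G :=
  [tuple ((nth 1 s i)^-1 * nth 1 s i.+1)%g | i < k].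

Definition unbar k (t : k.-tuple G) : seq G :=
  mkseq (fun i => foldl *%g 1%g (take i t)) k.+1.

Lemma size_unbar k (t : k.-tuple G) : size (unbar t) = k.+1.
Proof. exact: size_mkseq. Qed.

Lemma unbarK k (t : k.-tuple G) : bar k (unbar t) = t.
Proof.
apply: eq_from_tnth => i.
rewrite tnth_mktuple !nth_mkseq ?ltnS ?(ltnW (ltn_ord i)) //.
rewrite (take_nth 1%g) ?size_tuple // -cats1 foldl_cat /= mulKg.
by rewrite (tnth_nth 1%g).
Qed.

Lemma barK k (s : seq G) : size s = k.+1 ->
  translate (head 1%g s) (unbar (bar k s)) = s.
Proof.
move=> sk; apply: (@eq_from_nth _ 1%g); rewrite size_map size_unbar // => i ik.
rewrite (nth_map 1%g) ?size_unbar // nth_mkseq //.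
elim: i ik => [|i IHi] ik; first by rewrite take0 /= mulg1 nth0.
rewrite (take_nth 1%g) ?size_tuple // -cats1 foldl_cat /= mulgA IHi 1?ltnW //.
have := tnth_nth 1%g (bar k s) (Ordinal (ik : (i < k)%N)).
by rewrite tnth_mktuple /= => <-; rewrite mulVKg.
Qed.

Lemma bar_translate k a (s : seq G) : size s = k.+1 ->
  bar k (translate a s) = bar k s.
Proof.
move=> sk; apply: eq_from_tnth => i; rewrite !tnth_mktuple.
by rewrite !(nth_map 1%g) ?sk ?ltnS ?(ltnW (ltn_ord i)) // invgM -mulgA mulKg.
Qed.

Definition homogenize k (F : k.-tuple G -> R^o) (s : seq G) : R^o :=
  if size s == k.+1 then F (bar k s) else 0.

(** Forgetting an inner vertex of a simplex multiplies two adjacent entries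
    of its bar notation; forgetting an extreme vertex drops an extreme
    entry. *)
Lemma homogenize_bd k (F : k.-tuple G -> R^o) s : size s = k.+2 ->
  ext (homogenize F) (bd << s >>) = ext F (@boundary_basis R G k (bar k.+1 s)).
Proof.
move=> sk.
have hF (i : 'I_k.+2) : homogenize F (face i s) = F (bar k (face i s)).
  by rewrite /homogenize size_face sk ?ltn_ord // eqxx.
have nthE (i : 'I_k.+2) j : nth 1%g (face i s) j = nth 1%g s (bump i j).
  by rewrite nth_face // sk.
rewrite bd_faces sk linear_sum /=.
under eq_bigr do rewrite linearZ /= ext_basis hF.
rewrite big_ord_recl big_ord_recr /= expr0 scale1r.
rewrite /boundary_basis !linearD linear_sum /= !linearZ /= !ext_basis addrA.
congr (_ + _ + _ *: _).
- congr F; apply: eq_from_tnth => i; rewrite !tnth_mktuple.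
  by rewrite !(nthE ord0).
- apply: eq_bigr => j _; rewrite linearZ /= ext_basis; congr (_ *: F _).
  apply: eq_from_tnth => i; rewrite !tnth_mktuple.
  rewrite !(nthE (fintype.lift ord0 (widen_ord (leqnSn k) j))) /= /bump /=.
  rewrite !add1n !ltnS; case: (ltngtP i j) => [ij|ji|->].
  + by rewrite !add0n.
  + by rewrite !add1n.
  + by rewrite add0n add1n -mulgA mulVKg.
- congr F; apply: eq_from_tnth => i; rewrite !tnth_mktuple.
  rewrite !(nthE (fintype.lift ord0 ord_max)) /= /bump /=.
  by rewrite !add1n ltnS (leqNgt k) ltn_ord ltnNge (ltnW (ltn_ord i)) !add0n.
Qed.

Lemma cochain_is_linear k (f : cochain R G k) : linear (f : chain R G k -> R^o).
Proof. by case: f => f /= /asboolP[]. Qed.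

HB.instance Definition _ k (f : cochain R G k) :=
  GRing.isLinear.Build R (chain R G k) R^o *:%R f (@cochain_is_linear k f).

Lemma ext_bounded_functional k (F : k.-tuple G -> R^o) (C : R) :
  (forall t, `|F t| <= C) ->
  @bounded_functional R G k (ext F : chain R G k -> R^o).
Proof.
move=> FC; apply/asboolP; split; first by move=> a x y; exact: linearP.
exists C => c; rewrite -{1}[c]freeg_sumE linear_sum.
apply: le_trans (ler_norm_sum _ _ _) _; rewrite mulr_sumr.
apply: ler_sum => g _; rewrite /= /ext liftU normrM mulrC.
exact: ler_wpM2r.
Qed.

Lemma cochain_bounded k (f : cochain R G k) :
  exists C : R, forall t, `|f << t >>| <= C.
Proof.
case: f => f /= /asboolP[_ [C fC]]; exists C => t.
by apply: le_trans (fC _) _; rewrite l1norm_basis mulr1.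
Qed.

Lemma coboundary_basis k (f : cochain R G k) t :
  coboundary f << t >> = ext (fun t' => f << t' >>) (boundary_basis R t).
Proof.
have -> : coboundary f << t >> = f (boundary_basis R t).
  by rewrite /= /boundary liftU scale1r.
exact: (linear_ext f).
Qed.

Lemma eq_cochain k (f f' : cochain R G k) :
  (forall t, f << t >> = f' << t >>) -> f = f'.
Proof. by move=> ff'; apply: val_inj; apply/funext; apply: eq_linear. Qed.

End Bar.

(** * Limits of uniformly bounded functionals *)

Section UltraLimit.

Lemma ultra_cvg_compact (I : Type) (T : topologicalType) (U : set_system I)
    (f : I -> T) (A : set T) :
  UltraFilter U -> compact A -> (forall i, A (f i)) ->
  exists2 x, A x & f i @[i --> U] --> x.
Proof.
move=> UU Ac fA; have [|x [Ax clx]] := Ac (f i @[i --> U]) _.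
  exact: (filterS (fun i _ => fA i) filterT).
exists x => // V Vx; have [//|UnV] := in_ultra_setVsetC (f @^-1` V) UU.
by have [y [nVy Vy]] := clx (~` V) V UnV Vx.
Qed.

(** A family of uniformly bounded functionals, indexed by finite lists, has
    a limit along an ultrafilter finer than the inclusion order. Every
    linear equation satisfied by all large members of the family passes to
    the limit. *)
Lemma bounded_compactness (R : realType) (X : eqType) (T : choiceType)
    (u : seq X -> T -> R^o) (C : R) :
    (forall l t, `|u l t| <= C) ->
  exists v : T -> R^o, (forall t, `|v t| <= C) /\
    forall (c : {freeg T / R}) (r : R) (l0 : seq X),
      (forall l : seq X, {subset l0 <= l} -> ext (u l) c = r) -> ext v c = r.
Proof.
move=> uC.
pose F : set_system (seq X) :=
  [set A | exists l0 : seq X, forall l : seq X, {subset l0 <= l} -> A l].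
have FF : ProperFilter F.
  split; first by move=> [l0 /(_ l0)]; exact.
  split; first by exists [::].
    move=> A B [la lA] [lb lB]; exists (la ++ lb) => l lab; split.
      by apply: lA => x xa; apply: lab; rewrite mem_cat xa.
    by apply: lB => x xa; apply: lab; rewrite mem_cat xa orbT.
  by move=> A B AB [la lA]; exists la => l /lA /AB.
have [U [UU FU]] := ultraFilterLemma FF.
have ulim t : exists x : R^o, `[- C, C]%classic x /\ u l t @[l --> U] --> x.
  have [||x xC ux] :=
    @ultra_cvg_compact _ R^o U (fun l => u l t) `[- C, C]%classic UU.
  - exact: segment_compact.
  - by move=> l /=; rewrite in_itv /= -ler_norml.
  - by exists x.
have [v vlim] := choice ulim.
exists v; split=> [t|c r l0 cr].
  by have [+ _] := vlim t; rewrite /= in_itv /= -ler_norml.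
have extE (F' : T -> R^o) : ext F' c = \sum_(t <- dom c) coeff t c * F' t.
  rewrite -{1}[c]freeg_sumE linear_sum; apply: eq_bigr => t _.
  by rewrite /= /ext liftU.
have lim_v : ext (u l) c @[l --> U] --> (ext v c : R^o).
  rewrite extE (_ : (fun l => ext (u l) c) =
    (fun l => \sum_(t <- dom c) coeff t c * u l t)); last exact/funext.
  apply: (@cvg_big R^o _ +%R 0 predT) => [|t _]; first exact: add_continuous.
  by apply: cvgMl_tmp; exact: (vlim t).2.
have lim_r : ext (u l) c @[l --> U] --> (r : R^o).
  apply: cvg_near_cst; apply: FU; exists l0 => l l0l.
  by rewrite cr.
exact: (cvg_unique (@norm_hausdorff R R^o) lim_v lim_r).
Qed.

End UltraLimit.

(** * Vanishing of the bounded cohomology *)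

Section Vanishing.
Variables (R : realType) (G : groupType).
Hypothesis G_mitotic : mitotic G.

(** The faces of a constant simplex are equal, and cancel in pairs. *)
Lemma bd_nseq (X : choiceType) (x : X) m :
  bd << nseq m.+1 x >> = (~~ odd m)%:R *: << nseq m x >> :> {freeg (seq X) / R}.
Proof.
elim: m => [|m IHm]; first by rewrite bd_cons bd_nil linear0 subr0 scale1r.
rewrite [LHS](bd_cons _ x (nseq m.+1 x)) IHm linearZ /= cone_simplex negbK.
by case: (odd m); rewrite ?scale0r ?scale1r ?subr0 ?subrr.
Qed.

Lemma ext_cst_bd (X : choiceType) (a : R^o) (s : seq X) :
  ext (fun=> a) (bd << s >>) = a *+ odd (size s).
Proof.
elim: s => [|x s IHs]; first by rewrite bd_nil linear0.
rewrite bd_cons linearB /= ext_basis ext_cone IHs /=.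
by case: (odd _); rewrite ?mulr1n ?mulr0n ?subrr ?subr0.
Qed.

(** On the subgroup generated by a finite list [l], composing [f] with a
    contraction of that subgroup in [G] gives a primitive of [f] minus its
    value on the trivial subgroup, because [f] vanishes on boundaries. The
    norms of the contractions are uniformly bounded, so that these
    primitives have a limit. *)
Lemma cocycle_limit n (f : seq G -> R^o) (C : R) :
    (forall s, `|f s| <= C) ->
    (forall a s, f (translate a s) = f s) ->
    (forall s, ext f (bd << s >>) = 0) ->
  exists2 u : seq G -> R^o, exists C' : R, forall s, `|u s| <= C' &
    (forall a s, size s = n -> u (translate a s) = u s) /\
    (forall s, size s = n.+1 ->
      ext u (bd << s >>) = f s - f (nseq n.+1 1%g)).
Proof.
move=> fC f_inv f_bd.
have C0 : 0 <= C := le_trans (normr_ge0 _) (fC [::]).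
have f_coinv c : ext f (coinv c) = ext f c.
  apply: (@eq_linear _ _ _ (ext f \o @coinv R G) (ext f)) => s /=.
  by rewrite coinv_simplex !ext_basis /rebase f_inv.
have f_bd0 c : ext f (bd c) = 0.
  by apply: (@eq_linear _ _ _ (ext f \o @bd R G) \0) => s /=; rewrite f_bd.
have [K nullK] := mitotic_inclusion_null_homotopic R G_mitotic n.+1.
pose gen (l : seq G) : set G := generated [set` l].
have genG l : subgroup (gen l) by exact: subgroup_generated.
have gen_in l x : x \in l -> x \in gen l.
  by move=> xl; apply/mem_set; apply: sub_gen_smallest.
pose T l : groupType := subgroup_type (genG l).
have gen_fin l : finitely_generated (gen l) by exists [set` l].
pose h l := sval (cid (nullK _ (genG l) (gen_fin l))).
have hP l := svalP (cid (nullK _ (genG l) (gen_fin l))); rewrite -/(h _) in hP.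
(* Outside of the subgroup the value of [r l] is arbitrary: only the lists [l]
   that contain the vertices of a given simplex matter in the limit. *)
pose r l (x : G) : subgroup_type (genG l) := insubd 1%g x.
have rK l x : x \in gen l -> val (r l x) = x by move=> xl; rewrite /r insubdK.
have K0 : 0 <= K.
  by have [_ _ _ _ /(_ [::] isT)/bounded_ge0] := hP [::].
pose u l (s : seq G) : R^o :=
  if size s == n then ext f (h l (map (r l) s)) else 0.
have uC l s : `|u l s| <= K * C.
  rewrite /u; case: eqP => [sn|_]; last by rewrite normr0 mulr_ge0.
  have [_ _ _ _ hK] := hP l.
  by apply: hK fC; rewrite size_map sn.
have [v [vC vlim]] := bounded_compactness uC.
exists v; first by exists (K * C).
split=> [a s sn|s sn].
  apply/eqP; rewrite -subr_eq0; apply/eqP.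
  have := vlim (<< translate a s >> - << s >>) 0 (a :: s).
  rewrite linearB /= !ext_basis; apply=> l al.
  rewrite linearB /= !ext_basis /u size_map sn eqxx.
  have -> : map (r l) (translate a s) = translate (r l a) (map (r l) s).
    rewrite /translate -!map_comp; apply/eq_in_map => x xs /=.
    have a_gen : a \in gen l by apply: gen_in; apply: al; rewrite mem_head.
    have x_gen : x \in gen l by apply: gen_in; apply: al; rewrite inE xs orbT.
    apply: val_inj; rewrite val_subgroupM !rK //.
    exact: (group_closedM (genG l)).
  have [_ hA _ _ _] := hP l.
  by rewrite -f_coinv hA f_coinv subrr.
apply: (vlim _ _ s) => l sl.
have -> : ext (u l) (bd << s >>) = ext f (ext (h l) (bd << map (r l) s >>)).
  rewrite -mapc_simplex bd_mapc ext_mapc (linear_ext_comp (ext f)).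
  apply: eq_ext_bd => t; rewrite sn /u => -[->]; by rewrite eqxx.
have [_ _ _ heta _] := hP l.
have := congr1 (ext f) (heta (map (r l) s) _).
rewrite size_map sn => /(_ (leqnn _)).
rewrite linearD /= !f_coinv f_bd0 add0r => ->.
rewrite linearB /= !ext_basis -!map_comp; congr (f _ - f _).
  rewrite -[RHS]map_id; apply/eq_in_map => x xs /=.
  by rewrite rK //; apply/gen_in/sl.
by rewrite -[RHS]/(nseq n.+1 1%g) -sn; elim: (s) => //= x t ->.
Qed.

Lemma bounded_cocycle_is_coboundary n (z : cochain R G n.+1) :
  coboundary z = 0 -> exists f : cochain R G n, coboundary f = z.
Proof.
move=> dz.
pose F := homogenize (fun t => z << t >>).
have [C zC] := cochain_bounded z.
have C0 : 0 <= C := le_trans (normr_ge0 _) (zC [tuple 1%g | i < n.+1]).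
have F_bd s : ext F (bd << s >>) = 0.
  have [sn|/eqP sn] := eqVneq (size s) n.+3.
    by rewrite homogenize_bd // -coboundary_basis dz.
  rewrite (eq_ext_bd (F' := fun=> 0)) ?ext_cst0 // => t ts.
  rewrite /F /homogenize; case: eqP => // tn.
  by case: sn; rewrite -ts tn.
have [||//|u [C' uC] [u_inv u_bd]] := @cocycle_limit n.+1 F C.
- move=> s; rewrite /F /homogenize; case: eqP => _ //.
  by rewrite normr0.
- move=> a s; rewrite /F /homogenize size_map; case: eqP => // sn.
  by rewrite bar_translate.
(* The limit is a primitive of [F - a].  The constant [a] is its own primitive
   in odd size, and vanishes otherwise since [F] is a cocycle. *)
pose a := F (nseq n.+2 1%g).
have a0 : ~~ odd n.+2 -> a = 0.
  move=> n_even; have := F_bd (nseq n.+3 1%g).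
  by rewrite bd_nseq linearZ /= ext_basis n_even scale1r.
pose w (t : n.-tuple G) : R^o := u (unbar t) + a.
have wC t : `|w t| <= C' + `|a|.
  by apply: le_trans (ler_normD _ _) _; rewrite lerD2r.
exists (Cochain (ext_bounded_functional wC)).
apply: eq_cochain => t; rewrite coboundary_basis.
rewrite -[t in LHS]unbarK -homogenize_bd ?size_unbar //.
rewrite (eq_ext_bd (F' := fun s => u s + a)); last first.
  move=> s; rewrite size_unbar => -[sn].
  rewrite /homogenize sn eqxx /= ext_basis.
  by rewrite /w -[in RHS](barK sn) u_inv ?size_unbar.
have -> : ext (fun s => u s + a) (bd << unbar t >>) =
    ext u (bd << unbar t >>) + ext (fun=> a) (bd << unbar t >>).
  exact: ext_addfun.
rewrite ext_cst_bd u_bd size_unbar // -/a.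
rewrite (_ : a *+ odd n.+2 = a); last first.
  by case: (boolP (odd n.+2)) => [_|/a0 ->]; rewrite ?mul0rn.
by rewrite subrK /F /homogenize size_unbar eqxx unbarK.
Qed.

Lemma Hb_subsingleton n (x y : Hb R G n.+1) : x = y.
Proof.
elim/quotW: x => z; elim/quotW: y => z'.
apply/eqP; rewrite -Quotient.idealrBE unfold_in; apply/asboolP.
by apply: bounded_cocycle_is_coboundary; case: (z - z') => f /= /eqP.
Qed.

End Vanishing.

Section DegreeZero.
Variables (R : realType) (G : groupType).

(** The two faces of a 1-simplex of the bar complex are the same point. *)
Lemma boundary_basis0 (t : 1.-tuple G) : boundary_basis R t = 0.
Proof.
rewrite /boundary_basis big_ord0 addr0 expr1 scaleN1r.
by rewrite [last_face t]tuple0 [first_face t]tuple0 subrr.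
Qed.

Lemma Hb0_neq0 : exists x : Hb R G 0, x != 0.
Proof.
have cB (t : 0.-tuple G) : `|(1 : R^o)| <= 1 :> R by rewrite normr1.
pose f : cochain R G 0 := Cochain (ext_bounded_functional cB).
have fZ : is_cocycle f.
  apply/eqP/eq_cochain => t.
  by rewrite coboundary_basis boundary_basis0 linear0.
pose z : cocycle R G 0 := Cocycle fZ.
exists (\pi_(Hb R G 0) z)%qT.
apply/eqP => /eqP; rewrite -[X in _ == X]pi_zeror.
rewrite -Quotient.idealrBE subr0 unfold_in => /eqP z0.
have /eqP : f << [tuple] >> = 0 by rewrite -[f]/(cocycle_val z) z0.
by rewrite /= ext_basis oner_eq0.
Qed.

End DegreeZero.

Theorem theorem1p2 (R : realType) (G : groupType) :
  mitotic G -> bcd R G = 0%E.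
Proof.
move=> G_mitotic; rewrite /bcd (_ : [set n : nat | _] = [set 0%N]).
  by rewrite image_set1 ereal_sup1.
apply/seteqP; split=> [[//|n] /= [x]|n -> /=]; last exact: Hb0_neq0.
by rewrite (Hb_subsingleton G_mitotic x 0) eqxx.
Qed.
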